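(* Let $A\in\mathbb{C}^{n\times n}$ be a general non-singular matrix. Let $\mathcal I\subseteq\{1,2,\dots,n\}$ be a subset with cardinality $|\mathcal I|=n_c$, and let $M\in\mathbb{C}^{n\times n}$ be a non-singular matrix (the smoother) such that $M^{-1}A$ is diagonalizable. Consider the left and right generalized eigenvectors $V_l=[\check{\mathbf v}_1,\dots,\check{\mathbf v}_n]$ and $V_r=[\hat{\mathbf v}_1,\dots,\hat{\mathbf v}_n]$ of the matrix pencil $(A,M)$, with corresponding eigenvalues $\lambda_1,\dots,\lambda_n$. Let the interpolation operator $P\in\mathbb{C}^{n\times n_c}$ and the restriction operator $R\in\mathbb{C}^{n_c\times n}$ satisfy $$\operatorname{range}(P)=\operatorname{span}\{\hat{\mathbf v}_\ell:\ell\in\mathcal I\},\qquad \operatorname{range}(R^* )=\operatorname{span}\{\check{\mathbf v}_\ell:\ell\in\mathcal I\}.$$ Then the spectral radius of the two-grid error transfer operator $$E_{TG}(P,R)=(I-P(RAP)^{-1}RA)(I-M^{-1}A)$$ is given by $$\rho\left(E_{TG}(P,R)\right)=\max_{\ell\notin\mathcal I}|1-\lambda_\ell|.$$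
   Context: $(\cdot)^*$ denotes the conjugate transpose and $\rho(\cdot)$ the spectral radius. The coarse dimension satisfies $n_c<n$. The matrices $V_r,V_l\in\mathbb{C}^{n\times n}$ of right and left generalized eigenvectors (full sets of $n$ linearly independent eigenvectors) are defined by $$AV_r=MV_r\Lambda,\qquad V_l^*A=\Lambda V_l^*M,$$ with $\Lambda=\operatorname{diag}(\lambda_1,\dots,\lambda_n)$. *)

(* Defs.v *)
From mathcomp Require Import all_boot all_order all_algebra.
From mathcomp Require Import complex classical_sets reals.

Set Implicit Arguments.
Unset Strict Implicit.
Unset Printing Implicit Defensive.

Import Order.TTheory GRing.Theory Num.Theory.
Local Open Scope ring_scope.
Local Open Scope complex_scope.

(* [Normc.normc a] is |a| as an element of R (the norm `|a| lives in R[i]).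
   [eigenvalue] is stated with row eigenvectors, which give the same spectrum
   as column eigenvectors. For n > 0 the set is finite and nonempty, so that
   the supremum is a maximum. *)
Definition spectral_radius (R : realType) (n : nat) (A : 'M[R[i]]_n) : R :=
  sup [set Normc.normc a | a in [set a : R[i] | eigenvalue A a]]%classic.

(* MathComp encodes subspaces as row spaces, hence the (non-conjugating)
   transpositions in the next two definitions. *)
Definition colrange (F : fieldType) (m k : nat) (P : 'M[F]_(m, k)) : 'M[F]_m :=
  <<P^T>>%MS.

Definition span_cols (F : fieldType) (m n : nat) (V : 'M[F]_(m, n))
    (I : {set 'I_n}) : 'M[F]_m :=
  (\sum_(l in I) <<(col l V)^T>>)%MS.

(* [invmx X] is X^-1 only for X \in unitmx. *)
Definition two_grid (F : fieldType) (n nc : nat) (A M : 'M[F]_n)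
    (P : 'M[F]_(n, nc)) (Rst : 'M[F]_(nc, n)) : 'M[F]_n :=
  (1%:M - P *m invmx (Rst *m A *m P) *m Rst *m A) *m (1%:M - invmx M *m A).

(* Main.v *)
Require Import Defs.
From mathcomp Require Import all_boot all_order all_algebra.
From mathcomp Require Import spectral complex reals.
From mathcomp Require classical_sets.

Import Order.TTheory GRing.Theory Num.Theory.
Local Open Scope sesquilinear_scope.
Local Open Scope ring_scope.
Local Open Scope complex_scope.

(** The matrix [Q = I - P (RAP)^-1 RA] annihilates range P = span {v_l : l in I}
    and is the identity modulo that subspace.  Since [I - M^-1 A] is diagonal in
    the basis [Vr], the operator [Q (I - M^-1 A)] has in this basis the block form
    [[0, *], [0, diag (1 - lambda_l)_(l notin I)]], whose spectrum can be read off. *)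

(** After transposition, [u *m P = 0] says that the row space of [P^T] lies in the kernel of [u^T],
    and this inclusion can be tested on the generators of a larger span. *)
Lemma mulmx_colrange_eq0 {F : fieldType} {m k n : nat} (P : 'M[F]_(m, k))
    (V : 'M[F]_(m, n)) (I : {set 'I_n}) (u : 'rV[F]_m) :
  (colrange P <= span_cols V I)%MS ->
  (forall l, l \in I -> u *m col l V = 0) -> u *m P = 0.
Proof.
rewrite genmxE => sPV uV0; apply: trmx_inj.
rewrite trmx_mul trmx0; apply/sub_kermxP/(submx_trans sPV)/sumsmx_subP => l lI.
by rewrite genmxE; apply/sub_kermxP; rewrite -trmx_mul uV0 // trmx0.
Qed.

Lemma col_sub_colrange {F : fieldType} {m k n : nat} (P : 'M[F]_(m, k))
    (V : 'M[F]_(m, n)) (I : {set 'I_n}) (l : 'I_n) :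
  (span_cols V I <= colrange P)%MS -> l \in I -> exists x, col l V = P *m x.
Proof.
rewrite genmxE => sVP lI.
have /submxP[x ex] : ((col l V)^T <= P^T)%MS.
  by apply: submx_trans sVP; rewrite (sumsmx_sup l) ?genmxE.
by exists x^T; apply: trmx_inj; rewrite trmx_mul trmxK.
Qed.

Lemma eigenvalue_conj {F : fieldType} {n : nat} {T V N : 'M[F]_n} :
  V \in unitmx -> T *m V = V *m N -> eigenvalue T =1 eigenvalue N.
Proof.
move=> Vu TV a; apply/eigenvalueP/eigenvalueP => -[w wE w0].
- exists (w *m V); first by rewrite -mulmxA -TV mulmxA wE scalemxAl.
  by apply: contra w0 => /eqP e; rewrite -(mulmxK Vu w) e mul0mx.
- exists (w *m invmx V).
    by rewrite -[T](mulmxK Vu) TV !mulmxA mulmxKV // wE scalemxAl.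
  by apply: contra w0 => /eqP e; rewrite -(mulmxKV Vu w) e mul0mx.
Qed.

Section BlockTriangular.

Variables (F : fieldType) (n : nat) (I : {set 'I_n}) (N : 'M[F]_n) (d : 'rV[F]_n).
Hypothesis N0 : forall i j, j \in I -> N i j = 0.
Hypothesis ND : forall i j, i \notin I -> j \notin I -> N i j = d 0 j *+ (i == j).

(** Row [l] of [N] is zero off the diagonal, so the basis row vector at [l] is an eigenvector. *)
Lemma eigenvalue_block (l : 'I_n) : l \notin I -> eigenvalue N (d 0 l).
Proof.
move=> lI; apply/eigenvalueP; exists (delta_mx 0 l).
  apply/rowP => j; rewrite -rowE !mxE eqxx eq_sym /=.
  have [jI|jI] := boolP (j \in I).
    by rewrite N0 //; case: eqP jI lI => [->->|]; rewrite ?mulr0.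
  by rewrite ND // eq_sym; case: eqP => [->|]; rewrite ?mulr1 ?mulr0.
by apply/eqP => /rowP/(_ l)/eqP; rewrite !mxE !eqxx oner_eq0.
Qed.

(** Since the columns of [N] in [I] vanish, [w *m N = a *: w] with [a != 0] forces [w] to vanish on
    [I]. Any nonzero coordinate [j] of [w] then lies outside [I], and comparing entries at [j] gives
    [a = d 0 j]. *)
Lemma eigenvalue_blockP (a : F) :
  eigenvalue N a -> a != 0 -> exists2 l, l \notin I & a = d 0 l.
Proof.
move=> /eigenvalueP[w wE w0] a0.
have wI j : j \in I -> w 0 j = 0.
  move=> jI; move/rowP/(_ j): wE; rewrite !mxE big1; last first.
    by move=> i _; rewrite N0 ?mulr0.
  by move/esym/eqP; rewrite mulf_eq0 (negPf a0) => /eqP.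
have [j wj] : exists j, w 0 j != 0 by apply/rV0Pn.
have jI : j \notin I by apply: contra wj => /wI ->.
exists j => //; apply: (mulIf wj).
move/rowP/(_ j): wE; rewrite !mxE => <-.
rewrite (bigD1 j) //= ND // eqxx mulr1n big1 ?addr0 => [|i ij]; first exact: mulrC.
have [/wI ->|iI] := boolP (i \in I); first by rewrite mul0r.
by rewrite ND // (negPf ij) mulr0.
Qed.

End BlockTriangular.

Arguments eigenvalue_block {F n I N d} N0 ND l.
Arguments eigenvalue_blockP {F n I N d} N0 ND {a}.

(** The witness is [Vr^-1 Q Vr diag(1 - lambda)]. Its entries with row in [I] and column outside [I]
    are left unspecified, as they do not affect the spectrum. *)
Lemma two_grid_block {F : fieldType} {n nc : nat} {A M Vr : 'M[F]_n}
    {lambda : 'rV[F]_n} {I : {set 'I_n}} {P : 'M[F]_(n, nc)} {Rst : 'M[F]_(nc, n)} :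
  M \in unitmx -> Vr \in unitmx -> A *m Vr = M *m Vr *m diag_mx lambda ->
  (colrange P :=: span_cols Vr I)%MS -> Rst *m A *m P \in unitmx ->
  exists N : 'M[F]_n,
  [/\ two_grid A M P Rst *m Vr = Vr *m N,
      forall i j, j \in I -> N i j = 0
    & forall i j, i \notin I -> j \notin I -> N i j = (1 - lambda 0 j) *+ (i == j)].
Proof.
move=> Mu Vu eAV eP RAPu.
pose Q := 1%:M - P *m invmx (Rst *m A *m P) *m Rst *m A.
pose K := invmx Vr *m Q *m Vr; pose d := const_mx 1 - lambda.
have QP : Q *m P = 0.
  by rewrite mulmxBl mul1mx -!mulmxA (mulmxA Rst) mulVmx // mulmx1 subrr.
have NE i j : (K *m diag_mx d) i j = K i j * (1 - lambda 0 j).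
  by rewrite mul_mx_diag !mxE.
exists (K *m diag_mx d); split.
- have SV : (1%:M - invmx M *m A) *m Vr = Vr *m diag_mx d.
    rewrite mulmxBl mul1mx -mulmxA eAV -mulmxA mulKmx //.
    by rewrite linearB /= diag_const_mx mulmxBr mulmx1.
  by rewrite /two_grid -(mulmxA _ _ Vr) SV -/Q /K -!mulmxA mulKVmx.
- move=> i j jI; rewrite NE.
  (* The eigenvector [col j Vr] lies in the range of [P], which [Q] annihilates. *)
  have [x ex] : exists x, col j Vr = P *m x.
    by apply: col_sub_colrange jI; rewrite eP.
  have : col j K = 0.
    by rewrite /K -mulmxA !colE -!mulmxA -colE ex (mulmxA Q) QP mul0mx mulmx0.
  by move/colP/(_ i); rewrite !mxE => ->; rewrite mul0r.
- move=> i j iI jI; rewrite NE.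
  (* The rows of [invmx Vr] are dual to the columns of [Vr]: for [i] outside [I], row [i] kills
     every [col l Vr] with [l] in [I], hence the range of [P]. The correction term of [Q] thus drops
     out of row [i] of [K]. *)
  have rP : row i (invmx Vr) *m P = 0.
    apply: (@mulmx_colrange_eq0 _ _ _ _ _ Vr I) => [|l lI]; first by rewrite eP.
    rewrite colE mulmxA -row_mul mulVmx //; apply/rowP => k.
    rewrite -colE !mxE; case: eqP => // il.
    by rewrite il lI in iI.
  have : row i K = row i 1%:M.
    rewrite /K !row_mul mulmxBr mulmx1 !mulmxA rP !mul0mx subr0.
    by rewrite -row_mul mulVmx.
  move/rowP/(_ j); rewrite !mxE => ->.
  by case: eqP; rewrite ?mul1r ?mul0r.
Qed.

(** An attained upper bound is the supremum; [a] gives the nonemptiness and [r] the boundedness that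
    [sup] requires. *)
Lemma spectral_radius_max {R : realType} {n : nat} {T : 'M[R[i]]_n} {r : R} (a : R[i]) :
  eigenvalue T a -> Normc.normc a = r ->
  (forall b, eigenvalue T b -> Normc.normc b <= r) -> spectral_radius T = r.
Proof.
move=> Ta ar ub.
have ubS : classical_sets.ubound (classical_sets.image (eigenvalue T) (@Normc.normc R)) r.
  by move=> _ [b Tb <-]; apply: ub.
apply/le_anti/andP; split.
  apply: ge_sup => //; by exists r, a.
apply: ub_le_sup; first by exists r.
by exists a.
Qed.

Theorem theorem5p1 (R : realType) (n nc : nat) (hnc : (nc < n)%N)
    (A M : 'M[R[i]]_n) (hA : A \in unitmx) (hM : M \in unitmx)
    (hdiag : diagonalizable (invmx M *m A))
    (I : {set 'I_n}) (hI : #|I| = nc)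
    (lambda : 'rV[R[i]]_n) (Vr Vl : 'M[R[i]]_n)
    (hVr : Vr \in unitmx) (hVl : Vl \in unitmx)
    (hr : A *m Vr = M *m Vr *m diag_mx lambda)
    (hl : Vl ^t* *m A = diag_mx lambda *m Vl ^t* *m M)
    (P : 'M[R[i]]_(n, nc)) (Rst : 'M[R[i]]_(nc, n))
    (hP : (colrange P :=: span_cols Vr I)%MS)
    (hR : (colrange (Rst ^t*) :=: span_cols Vl I)%MS)
    (hRAP : Rst *m A *m P \in unitmx) :
  spectral_radius (two_grid A M P Rst) =
  \big[Order.max/0]_(l | l \notin I) Normc.normc (1 - lambda 0 l).
Proof.
have [N [TV N0 N1]] := two_grid_block hM hVr hr hP hRAP.
pose d := const_mx 1 - lambda.
have dE j : d 0 j = 1 - lambda 0 j by rewrite !mxE.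
have ND i j : i \notin I -> j \notin I -> N i j = d 0 j *+ (i == j).
  by rewrite dE; apply: N1.
have [l0 l0I] : exists l, l \notin I.
  have : (0 < #|~: I|)%N by rewrite cardsCs setCK card_ord hI subn_gt0.
  by case/card_gt0P => l; rewrite inE; exists l.
have normc_ge0 (z : R[i]) : 0 <= Normc.normc z by case: z => x y; apply: sqrtr_ge0.
(* The default value 0 is below all the moduli and the index set contains [l0], so the maximum is
   attained at some [l] outside [I]. *)
have [l lI lE] := @eq_bigmax _ _ _ 0 l0 (fun l => l \notin I)
   (fun l => Normc.normc (1 - lambda 0 l)) l0I (fun l _ => normc_ge0 _).
apply: (spectral_radius_max (1 - lambda 0 l)) => //.
  by rewrite (eigenvalue_conj hVr TV) -dE; apply: eigenvalue_block N0 ND l lI.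
move=> b; rewrite (eigenvalue_conj hVr TV) => Nb.
(* The eigenvalue 0 may come from the zero columns instead of some [1 - lambda 0 j]; its modulus is
   still at most the maximum, which is nonnegative. *)
have [->|b0] := eqVneq b 0.
  by rewrite Normc.normc0 lE normc_ge0.
have [j jI ->] := eigenvalue_blockP N0 ND Nb b0.
by rewrite dE; apply: (le_bigmax_cond _ (fun l => Normc.normc (1 - lambda 0 l))).
Qed.
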